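(* The following assertion is false: ''Let $G$ be a permutation graph with chordless cycles $C_1$ and $C_2$ such that $C_1\cup C_2$ is a 2-factor of $G$. If $G$ is cyclically 5-edge-connected and there is no cycle double cover of $G$ which includes both $C_1$ and $C_2$, then $G$ is the Petersen graph.''
   Context: A cycle is a connected 2-regular graph. A 2-factor of a graph is a spanning 2-regular subgraph. A permutation graph is a cubic graph which has a 2-factor consisting of two induced (chordless) cycles. A cycle double cover of a graph $G$ is a multiset of cycles of $G$ such that each edge of $G$ lies in exactly two of them. A graph is cyclically $k$-edge-connected if the deletion of fewer than $k$ edges does not create two components both of which contain at least one cycle. *)

(* Defs.v *)
From HB Require Import structures.
From mathcomp Require Import all_boot.
From mathcomp Require Import finmap multiset.

Set Implicit Arguments.
Unset Strict Implicit.
Unset Printing Implicit Defensive.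

(* A finite simple graph whose vertices are drawn from an ambient finite type *)
(* T: a vertex set V together with a set of edges, each edge being a          *)
(* two-element subset of V. Keeping V separate from T lets a graph and its    *)
(* subgraphs share the type graph T.                                          *)
Definition wf_graph (T : finType) (p : {set T} * {set {set T}}) : bool :=
  [forall e in p.2, (#|e| == 2) && (e \subset p.1)].

Record graph (T : finType) := Graph {
  graph_val : {set T} * {set {set T}};
  graph_valP : wf_graph graph_val }.

HB.instance Definition _ (T : finType) := [isSub for @graph_val T].
HB.instance Definition _ (T : finType) := [Finite of graph T by <:].

Section Graphs.
Variable T : finType.
Implicit Types (G H K C : graph T) (F : {set {set T}}).

Definition vertices G : {set T} := (graph_val G).1.
Definition edges G : {set {set T}} := (graph_val G).2.

Definition adjacent G : rel T := [rel x y | [set x; y] \in edges G].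

Definition degree G (x : T) : nat := #|[set e in edges G | x \in e]|.

Definition regular (k : nat) G : Prop :=
  forall x, x \in vertices G -> degree G x = k.

Definition connected G : Prop :=
  vertices G != set0 /\
  forall x y, x \in vertices G -> y \in vertices G ->
    connect (adjacent G) x y.

Definition subgraph H G : Prop :=
  vertices H \subset vertices G /\ edges H \subset edges G.

Definition induced_subgraph H G : Prop :=
  subgraph H G /\ edges H = [set e in edges G | e \subset vertices H].

Definition is_cycle C : Prop := connected C /\ regular 2 C.

Definition chordless_cycle G C : Prop :=
  is_cycle C /\ induced_subgraph C G.

Definition two_factor G H : Prop :=
  [/\ subgraph H G, vertices H = vertices G & regular 2 H].

Lemma wf_graph_union G H :
  wf_graph (vertices G :|: vertices H, edges G :|: edges H).
Proof.
apply/forall_inP => e /=; rewrite inE => /orP[] He.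
  have /forall_inP/(_ e He)/andP[-> /= sub] := graph_valP G.
  exact: subset_trans sub (subsetUl _ _).
have /forall_inP/(_ e He)/andP[-> /= sub] := graph_valP H.
exact: subset_trans sub (subsetUr _ _).
Qed.

Definition graph_union G H : graph T := Graph (wf_graph_union G H).

Lemma wf_delete_edges G F : wf_graph (vertices G, edges G :\: F).
Proof.
apply/forall_inP => e /=; rewrite inE => /andP[_ He].
exact: (forall_inP (graph_valP G)).
Qed.

Definition delete_edges G F : graph T := Graph (wf_delete_edges G F).

Definition permutation_graph G : Prop :=
  regular 3 G /\
  exists C1 C2 : graph T,
    [/\ C1 <> C2, chordless_cycle G C1, chordless_cycle G C2
      & two_factor G (graph_union C1 C2)].

Definition component G K : Prop :=
  [/\ subgraph K G, connected K
    & forall H, subgraph H G -> connected H -> subgraph K H -> H = K].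

Definition contains_cycle G : Prop := exists2 C, is_cycle C & subgraph C G.

Definition cyclically_edge_connected (k : nat) G : Prop :=
  forall F, F \subset edges G -> #|F| < k ->
    ~ exists K1 K2 : graph T,
        [/\ K1 <> K2,
            component (delete_edges G F) K1, component (delete_edges G F) K2,
            contains_cycle K1 & contains_cycle K2].

(* M C is the multiplicity of C in the multiset M. *)
Definition cycle_double_cover G (M : {mset graph T}%mset) : Prop :=
  (forall C, C \in M -> is_cycle C /\ subgraph C G) /\
  forall e, e \in edges G -> \sum_(C : graph T | e \in edges C) M C = 2.

End Graphs.

Definition isomorphic (T T' : finType) (G : graph T) (G' : graph T') : Prop :=
  exists f : T -> T',
    [/\ {in vertices G &, injective f},
        f @: vertices G = vertices G'
      & [set f @: e | e : {set T} in edges G] = edges G'].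

(* The Petersen graph as the Kneser graph K(5,2): the vertices are the        *)
(* two-element subsets of a five-element set, adjacent when disjoint.         *)
Definition petersen_vertices : {set {set 'I_5}} := [set A : {set 'I_5} | #|A| == 2].

Definition petersen_edges : {set {set {set 'I_5}}} :=
  [set [set A; B] | A : {set 'I_5} in petersen_vertices,
                    B : {set 'I_5} in petersen_vertices & [disjoint A & B]].

Lemma wf_petersen : wf_graph (petersen_vertices, petersen_edges).
Proof.
apply/forall_inP => e /imset2P[A B hA]; rewrite inE /= => /andP[hB dAB] ->.
rewrite cards2 subUset !sub1set hA hB !andbT eqSS eqb1.
apply: contraTneq dAB => <-; rewrite -setI_eq0 setIid -cards_eq0.
by move: hA; rewrite inE => /eqP ->.
Qed.

Definition petersen : graph {set 'I_5} := Graph wf_petersen.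

(* Main.v *)
Require Import Defs.
From mathcomp Require Import all_boot.
From mathcomp Require Import finmap multiset.

Set Implicit Arguments.
Unset Strict Implicit.
Unset Printing Implicit Defensive.

(** The assertion fails for a permutation graph with 34 vertices: two circles of
    length 17 joined by 17 spokes, the order of the spokes along the circles
    being [spoke_order]. Two properties of this graph need an argument, and each
    is turned into a finite search.

    Cyclic edge-connectivity. If deleting [F] leaves two components with cycles,
    then [F] contains the edge cut around the vertex set of one of them, and this
    set and its complement both have at least three vertices
    ([cyclically_edge_connectedI]). A branch-and-bound enumeration of the vertex
    sets with at most four boundary edges ([cuts_trivialP]) finds that each of
    them, or its complement, has at most two vertices.

    Cycle double covers. In a double cover containing both circles, every other
    member alternates between rim edges and spokes: a rim edge is already covered
    once by its circle, so exactly one other member contains it, and at each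
    vertex the two members containing the spoke leave along different rim edges.
    Label each rim edge by its second cover. Then the two rim edges at one end of
    a spoke have different labels, and the two rim edges at the other end have
    the same two labels, in one of two orders ([other_spoke]). Choosing an order
    at each spoke identifies labels; the search over these choices
    ([refutesP]) always ends by identifying the labels of the two rim edges at
    some vertex, so there is no such cover. *)

(** * Cyclic edge-connectivity and edge cuts *)

Section EdgeCuts.
Variable T : finType.
Implicit Types (G H K C : graph T) (S e : {set T}).

Lemma edge_card G e : e \in edges G -> #|e| = 2.
Proof. by move/(forall_inP (graph_valP G)) => /andP[/eqP]. Qed.

Lemma edge_sub G e : e \in edges G -> e \subset vertices G.
Proof. by move/(forall_inP (graph_valP G)) => /andP[]. Qed.

Lemma adjacent_sym G : symmetric (adjacent G).
Proof. by move=> x y; rewrite /adjacent /= setUC. Qed.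

Lemma edge_connect G e x y :
  e \in edges G -> x \in e -> y \in e -> connect (adjacent G) x y.
Proof.
move=> He; have /eqP/cards2P[a [b [_ eE]]] := edge_card He.
rewrite {}eE in He *; have Gab : adjacent G a b by [].
have Gba : adjacent G b a by rewrite adjacent_sym.
by rewrite !inE => /orP[]/eqP-> /orP[]/eqP->; rewrite ?connect0 ?connect1.
Qed.

Definition reach G x : {set T} := [set y | connect (adjacent G) x y].

Lemma reach_edge G x e y :
  e \in edges G -> y \in e -> y \in reach G x -> e \subset reach G x.
Proof.
move=> He ye; rewrite inE => xy; apply/subsetP => z ze; rewrite inE.
exact: connect_trans xy (edge_connect He ye ze).
Qed.

Lemma wf_reach_graph G x :
  wf_graph (reach G x, [set e in edges G | e \subset reach G x]).
Proof.
by apply/forall_inP => e; rewrite inE => /andP[/edge_card -> ->].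
Qed.

(** The component of [x] with an explicit vertex set; every abstract component
    through [x] coincides with it, which makes components comparable. *)
Definition reach_graph G x := Graph (wf_reach_graph G x).

Lemma connected_reach_graph G x : connected (reach_graph G x).
Proof.
have walk p : forall w, w \in reach G x -> path (adjacent G) w p ->
    path (adjacent (reach_graph G x)) w p.
  elim: p => //= z p IHp w xw /andP[Gwz Gp].
  have sub := reach_edge Gwz (set21 w z) xw.
  rewrite IHp ?(subsetP sub) ?set22 // andbT.
  by rewrite /adjacent /= inE sub andbT.
have to_y y : y \in reach G x -> connect (adjacent (reach_graph G x)) x y.
  rewrite inE => /connectP[p Gp ->]; apply/connectP; exists p => //.
  by apply: walk Gp; rewrite inE connect0.
split; first by apply/set0Pn; exists x; rewrite inE connect0.
move=> y z /to_y xy /to_y xz; apply: connect_trans xz.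
by rewrite (sym_connect_sym (adjacent_sym _)).
Qed.

(** The reachable part is connected and contains [K], so the maximality of [K]
    forces equality. *)
Lemma component_reach G K x :
  component G K -> x \in vertices K -> K = reach_graph G x.
Proof.
case=> -[subV subE] [_ conK] maxK xK; symmetry.
have Kx : vertices K \subset reach G x.
  apply/subsetP => y yK; rewrite inE.
  have := conK x y xK yK; apply: connect_sub => u v Kuv.
  exact/connect1/(subsetP subE).
apply: maxK; last split=> //; [split | exact: connected_reach_graph | ].
- apply/subsetP => y; rewrite inE => /connectP[p Gp ->].
  elim: p {xK Kx} x (subsetP subV x xK) Gp => //= z p IHp w _ /andP[Gwz Gp].
  by apply: IHp => //; exact: (subsetP (edge_sub Gwz)) (set22 _ _).
- by apply/subsetP => e; rewrite inE => /andP[].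
apply/subsetP => e Ke; rewrite inE (subsetP subE) //=.
exact: subset_trans (edge_sub Ke) Kx.
Qed.

Lemma cycle_card C : is_cycle C -> 2 < #|vertices C|.
Proof.
case=> -[/set0Pn[x xC] _] /(_ x xC)/eqP/cards2P[e [f [ef defE]]].
have [] : e \in [set e in edges C | x \in e] /\ f \in [set e in edges C | x \in e].
  by rewrite defE !inE !eqxx orbT.
rewrite !inE => /andP[He xe] /andP[Hf xf].
have sub: e :|: f \subset vertices C by rewrite subUset !edge_sub.
apply: leq_trans (subset_leq_card sub).
rewrite -[3]/(2.+1) -{1}(edge_card He); apply: proper_card.
rewrite properE subsetUl subUset subxx /=.
apply: contra ef => fe; rewrite eq_sym eqEcard fe.
by rewrite (edge_card He) (edge_card Hf).
Qed.

Definition edge_cut G S : {set {set T}} :=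
  [set e in edges G | ~~ (e \subset S) && ~~ (e \subset ~: S)].

(** A deletion that separates two cycles also deletes the whole edge cut around
    the vertex set of one of the two components. Both this set and its complement
    contain the vertex set of a cycle, hence three vertices. *)
Lemma cyclically_edge_connectedI k G :
  (forall S, 2 < #|S| -> 2 < #|~: S| -> k <= #|edge_cut G S|) ->
  cyclically_edge_connected k G.
Proof.
move=> cut F FG Fk [K1 [K2 [neK comp1 comp2 [C1 cyc1 [sub1 _]] [C2 cyc2 [sub2 _]]]]].
suff disj : vertices K2 \subset ~: vertices K1.
  have: k <= #|edge_cut G (vertices K1)|.
    apply: cut; first exact: leq_trans (cycle_card cyc1) (subset_leq_card sub1).
    apply: leq_trans (cycle_card cyc2) (subset_leq_card _).
    exact: subset_trans disj.
  rewrite leqNgt => /negP; apply; apply: leq_ltn_trans Fk.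
  apply/subset_leq_card/subsetP => e; rewrite inE => /andP[Ge].
  apply: contraTT => eF; rewrite negb_and !negbK.
  (* An edge outside F that meets K1 stays inside K1. *)
  rewrite orbC -implyNb; apply/implyP => /subsetPn[x xe]; rewrite inE negbK => xK.
  rewrite (component_reach comp1 xK).
  apply: (reach_edge _ xe); first by rewrite inE eF.
  by rewrite inE connect0.
apply/subsetP => x xK2; rewrite inE; apply: contra_notN neK => xK1.
by rewrite (component_reach comp1 xK1) (component_reach comp2 xK2).
Qed.
End EdgeCuts.

(** * Cubic graphs consisting of two circles joined by spokes *)

Section TwoCircles.
Variables (I : finType) (circ : bool -> seq I).
Hypothesis circ_uniq : forall c, uniq (circ c).
Hypothesis mem_circ : forall c i, i \in circ c.
Hypothesis I_big : 2 < #|I|.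

(** Vertex [(i, c)] lies on circle [c] and carries the name [i] of its spoke; the
    order of circle [c] is the cyclic sequence [circ c] of these names. *)
Notation vertex := (I * bool)%type.
Notation link := (option bool * I)%type.
Implicit Types (c : bool) (i : I) (u w : link) (v : vertex).

(** Edges are named by links, so that the edge set is the injective image of a
    finite type and degrees and cuts are counted on names. *)
Definition spoke i : link := (None, i).
Definition rim c i : link := (Some c, i).

Definition tail u : vertex := (u.2, odflt false u.1).
Definition head u : vertex :=
  if u.1 is Some c then (next (circ c) u.2, c) else (u.2, true).
Definition edge u : {set vertex} := [set tail u; head u].

(** Otherwise the circle would close up after two steps and [I] would have at
    most two elements. *)
Lemma next_next_neq c i : next (circ c) (next (circ c) i) != i.
Proof.
apply: contraTneq I_big => fixi; rewrite -leqNgt.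
have short : fcycle (next (circ c)) [:: i; next (circ c) i].
  by rewrite /= fixi !eqxx.
apply: leq_trans (card_size [:: i; next (circ c) i]).
apply/subset_leq_card/subsetP => j _.
rewrite -(fconnect_cycle short (mem_head _ _)).
by rewrite (fconnect_cycle (cycle_next (circ_uniq c))).
Qed.

Lemma next_neq c i : next (circ c) i != i.
Proof. by apply: contraNneq (next_next_neq c i) => fixi; rewrite !fixi. Qed.

Lemma edge_neq u : tail u != head u.
Proof.
case: u => [[c|] i]; rewrite /tail /head xpair_eqE /= ?andbF //.
by rewrite eqxx andbT eq_sym next_neq.
Qed.

Lemma in_edge i c u :
  ((i, c) \in edge u)
    = [|| u == spoke i, u == rim c i | u == rim c (prev (circ c) i)].
Proof.
have next_eq d j : (i == next (circ d) j) = (j == prev (circ d) i).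
  by rewrite eq_sym (can2_eq (prev_next _) (next_prev _)).
rewrite !inE; case: u => [[d|] j]; rewrite /tail /head /spoke /rim !xpair_eqE /=.
  by rewrite next_eq (eq_sym i); case: d; case: c; rewrite ?andbT ?andbF.
by rewrite (eq_sym i); case: c; rewrite ?andbT ?andbF ?orbF.
Qed.

(** A spoke joins different circles and a rim edge does not; two rim edges with
    the same ends would form a circle of length two. *)
Lemma edge_inj : injective edge.
Proof.
move=> u w eqE.
have: head u \in edge w by rewrite -eqE set22.
have: tail u \in edge w by rewrite -eqE set21.
case: u {eqE} => [[c|] i]; rewrite /tail /head /= !in_edge.
  have nextF := negbTE (next_neq c i).
  rewrite prev_next // => tail_w /or3P[]/eqP wE; rewrite wE // in tail_w *.
    by move: tail_w; rewrite /spoke /rim !xpair_eqE /= nextF.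
  move: tail_w; rewrite /spoke /rim !xpair_eqE /= eqxx /= nextF /=.
  rewrite -(can2_eq (prev_next _) (next_prev _)) //.
  by rewrite (negPf (next_next_neq c i)).
move=> /or3P[]/eqP-> //; rewrite /spoke /rim !xpair_eqE /=.
Qed.

Lemma wf_links (V : {set vertex}) (L : {set link}) :
  (forall u, u \in L -> edge u \subset V) -> wf_graph (V, edge @: L).
Proof.
move=> sub; apply/forall_inP => e /imsetP[u Lu ->].
by rewrite cards2 edge_neq sub.
Qed.

Lemma degree_links (G : graph vertex) (L : {set link}) v :
  edges G = edge @: L -> degree G v = #|[set u in L | v \in edge u]|.
Proof.
move=> defE; rewrite /degree defE -(card_imset _ edge_inj); congr #|pred_of_set _|.
apply/setP => e; rewrite inE; apply/andP/imsetP => [[/imsetP[u Lu ->] vu]|[u]].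
  by exists u => //; rewrite inE Lu.
by rewrite inE => /andP[Lu vu] ->; rewrite imset_f.
Qed.

Lemma wf_two_circle_graph : wf_graph ([set: vertex], edge @: [set: link]).
Proof. by apply: wf_links => u _; apply: subsetT. Qed.

Definition two_circle_graph := Graph wf_two_circle_graph.

Lemma wf_circle c :
  wf_graph ([set v : vertex | v.2 == c], edge @: [set u : link | u.1 == Some c]).
Proof.
apply: wf_links => -[d i]; rewrite inE /= => /eqP->.
by rewrite subUset !sub1set !inE /= eqxx.
Qed.

Definition circle c := Graph (wf_circle c).

Lemma links_at i c :
  [set u | (i, c) \in edge u]
    = [set spoke i; rim c i; rim c (prev (circ c) i)].
Proof. by apply/setP => u; rewrite inE in_edge !inE orbA. Qed.

Lemma prev_neq c i : prev (circ c) i != i.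
Proof. by rewrite -{2}(next_prev (circ_uniq c) i) eq_sym next_neq. Qed.

Lemma rims_card c i : #|[set rim c i; rim c (prev (circ c) i)]| = 2.
Proof. by rewrite cards2 /rim xpair_eqE eqxx /= eq_sym prev_neq. Qed.

Lemma two_circle_regular : regular 3 two_circle_graph.
Proof.
move=> [i c] _; rewrite (degree_links _ (erefl (edges two_circle_graph))).
under eq_finset => u do rewrite inE.
by rewrite links_at -setUA cardsU1 rims_card !inE.
Qed.

Lemma circle_regular c : regular 2 (circle c).
Proof.
move=> [i d]; rewrite inE /= => /eqP->.
rewrite (degree_links _ (erefl (edges (circle c)))) -(rims_card c i).
apply: eq_card => u; rewrite 2!inE in_edge [RHS]inE !in_set1.
by case: u => [[b|] j] //; rewrite /spoke /rim !xpair_eqE /= -andb_orr andbA andbb.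
Qed.

Lemma circle_connected c : connected (circle c).
Proof.
split.
  have /card_gt0P[i _] : 0 < #|I| by apply: leq_trans I_big.
  by apply/set0Pn; exists (i, c); rewrite inE.
have circ_cycle: cycle (adjacent (circle c)) [seq (i, c) | i <- circ c].
  rewrite cycle_map; apply: cycle_from_next => // i _.
  by rewrite /adjacent /= (imset_f edge (x := rim c i)) ?inE.
move=> [i a] [j b]; rewrite !inE /= => /eqP-> /eqP->.
by apply: (connect_cycle circ_cycle); apply: map_f.
Qed.

Lemma circle_chordless c : chordless_cycle two_circle_graph (circle c).
Proof.
split; first by split; [apply: circle_connected | apply: circle_regular].
split; first by split; [apply: subsetT | apply: imsetS; apply: subsetT].
apply/setP => e; rewrite inE; apply/idP/andP => [Ce | [/imsetP[u _ ->]]].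
  split; last exact: (edge_sub (G := circle c)).
  by apply: (subsetP (imsetS _ _)) Ce; apply: subsetT.
rewrite subUset !sub1set !inE => /andP[t_c h_c]; apply: imset_f; rewrite inE.
by case: u t_c h_c => [[d|] i] //=; case: c.
Qed.

Lemma circles_two_factor :
  two_factor two_circle_graph (graph_union (circle false) (circle true)).
Proof.
split=> [||[i c] _].
- split; first exact: subsetT.
  by rewrite subUset; apply/andP; split; apply: imsetS; apply: subsetT.
- by apply/setP => -[i c]; rewrite !inE; case: c.
have defE : edges (graph_union (circle false) (circle true))
    = edge @: ([set u : link | u.1 == Some false] :|: [set u | u.1 == Some true]).
  by rewrite imsetU.
rewrite (degree_links _ defE) -(rims_card c i).
apply: eq_card => u; rewrite inE in_edge !inE.
by case: u => [[[]|] j] //; rewrite /spoke /rim !xpair_eqE.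
Qed.

Lemma two_circle_permutation : permutation_graph two_circle_graph.
Proof.
split; first exact: two_circle_regular.
exists (circle false), (circle true); split; try exact: circle_chordless.
  have /card_gt0P[i _] : 0 < #|I| by apply: leq_trans I_big.
  move/(congr1 (fun C => (i, false) \in vertices C)).
  by rewrite !inE.
exact: circles_two_factor.
Qed.

Lemma card_edge_cut (S : {set vertex}) :
  #|edge_cut two_circle_graph S| = #|[set u | (tail u \in S) != (head u \in S)]|.
Proof.
rewrite -(card_imset _ edge_inj); apply: eq_card => e; rewrite inE.
apply/andP/imsetP => [[/imsetP[u _ ->]]|[u + ->]].
  rewrite !subUset !sub1set !in_setC => cut_u; exists u; rewrite // inE.
  by move: cut_u; case: (tail u \in S); case: (head u \in S).
rewrite inE => cut_u; split; first exact: imset_f.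
rewrite !subUset !sub1set !in_setC.
by move: cut_u; case: (tail u \in S); case: (head u \in S).
Qed.

(** * Cycle double covers containing both circles *)

(** Three edges meet at [(i, c)], and a cycle through this vertex uses two of
    them. *)
Lemma cycle_spoke (C : graph vertex) c i :
  is_cycle C -> subgraph C two_circle_graph -> edge (spoke i) \in edges C ->
  (edge (rim c (prev (circ c) i)) \in edges C) = (edge (rim c i) \notin edges C).
Proof.
move=> [_ regC] [_ subE] Ci; set L := edge @^-1: edges C.
have defE : edges C = edge @: L.
  apply/setP => e; apply/idP/imsetP => [Ce|[u + ->]]; last by rewrite inE.
  have /imsetP[u _ eE] := subsetP subE e Ce.
  by exists u; rewrite // inE -eE.
have iC : (i, c) \in vertices C.
  by apply: (subsetP (edge_sub Ci)); rewrite in_edge eqxx.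
have := regC _ iC; rewrite (degree_links _ defE).
case rC: (_ \in edges C); case pC: (_ \in edges C) => //= deg2.
  suff : 3 <= 2 by []; rewrite -[leqRHS]deg2.
  suff <- : #|[set u | (i, c) \in edge u]| = 3.
    apply/subset_leq_card/subsetP => u.
    rewrite inE => iu; rewrite 2!inE iu andbT; move: iu; rewrite in_edge.
    by case/or3P=> /eqP->.
  by rewrite links_at -setUA cardsU1 rims_card !inE.
suff : 2 <= 1 by []; rewrite -[leqLHS]deg2 -(cards1 (spoke i)).
apply/subset_leq_card/subsetP => u; rewrite 2!inE in_edge.
by case/andP=> + /or3P[]/eqP uE; rewrite uE ?rC ?pC // set11.
Qed.

Lemma sum_eq2 (K : finType) (P : pred K) (F : K -> nat) (a b c : K) :
    \sum_(k | P k) F k = 2 -> P a -> 0 < F a ->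
    P b -> b != a -> 0 < F b -> P c -> c != a -> 0 < F c ->
  F b = 1 /\ c = b.
Proof.
move=> + Pa Fa Pb ba Fb Pc ca Fc.
rewrite (bigD1 a) //= (bigD1 b) ?Pb //=.
case: (F a) (F b) Fa Fb => [|m] // [|k] // _ _.
rewrite addSn addnS => -[]/eqP; rewrite !addn_eq0 => /and3P[_ /eqP->].
rewrite sum_nat_eq0 => /forall_inP/(_ c) rest; split=> //.
by apply: contraTeq Fc => cb; rewrite -eqn0Ngt rest // Pc ca.
Qed.

Section DoubleCover.
Variable M : {mset graph vertex}%mset.
Hypothesis coverM : cycle_double_cover two_circle_graph M.
Hypothesis circleM : forall c, circle c \in M.

Lemma cover_sum u : \sum_(C | edge u \in edges C) M C = 2.
Proof. by case: coverM => _; apply; apply: imset_f. Qed.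

Lemma rim_circle c i : edge (rim c i) \in edges (circle c).
Proof. by apply: imset_f; rewrite inE. Qed.

Lemma spoke_circle c i : edge (spoke i) \notin edges (circle c).
Proof. by rewrite (mem_imset _ _ edge_inj) inE. Qed.

(** The circle itself accounts for one of the two covers of a rim edge. *)
Lemma rim_cover c i C C' :
    C \in M -> C != circle c -> edge (rim c i) \in edges C ->
    C' \in M -> C' != circle c -> edge (rim c i) \in edges C' ->
  M C = 1 /\ C' = C.
Proof.
move=> MC Cc Ci MC' C'c C'i; have MC0 := circleM c.
rewrite -!mset_gt0 in MC MC' MC0.
exact: sum_eq2 (cover_sum (rim c i)) (rim_circle c i) MC0 Ci Cc MC C'i C'c MC'.
Qed.

(** The member of the cover, besides circle [c], that covers [rim c i]; the
    default value is never taken when [M] is a double cover. *)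
Definition other c i : graph vertex :=
  odflt (circle c)
    [pick C in M | (C != circle c) && (edge (rim c i) \in edges C)].

Lemma other_eq c i C :
  C \in M -> C != circle c -> edge (rim c i) \in edges C -> other c i = C.
Proof.
move=> MC Cc Ci; rewrite /other; case: pickP => [C' /and3P[MC' C'c C'i]|/(_ C)].
  by case: (rim_cover MC Cc Ci MC' C'c C'i).
by rewrite MC Cc Ci.
Qed.

(** Two members of the cover contain the spoke [i], and neither is a circle. At
    each end of the spoke either of them continues along one rim edge, and they
    take different ones: a rim edge shared with the circle and both of them would
    be covered three times. So the two members seen on the rim at one end are the
    two members seen at the other end, either straight or crossed. *)
Lemma other_spoke i :
  [/\ other false (prev (circ false) i) != other false i,
      other true (prev (circ true) i) != other true i
    & (other false (prev (circ false) i) == other true (prev (circ true) i))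
      && (other false i == other true i)
   || (other false (prev (circ false) i) == other true i)
      && (other false i == other true (prev (circ true) i))].
Proof.
have spokeM C : edge (spoke i) \in edges C -> forall c, C != circle c.
  by move=> Ci c; apply: contraTneq Ci => ->; apply: spoke_circle.
have spoke_rim C c : C \in M -> edge (spoke i) \in edges C ->
    (edge (rim c (prev (circ c) i)) \in edges C) = (edge (rim c i) \notin edges C).
  by move=> /(proj1 coverM)[cycC subC]; apply: cycle_spoke.
have [C MC Ci] : exists2 C, C \in M & edge (spoke i) \in edges C.
  have : \sum_(C | edge (spoke i) \in edges C) M C != 0 by rewrite cover_sum.
  rewrite sum_nat_eq0 => /forall_inPn[C Ci]; rewrite mset_neq0 => MC.
  by exists C.
have MC1 : M C = 1.
  have [j Cj] : exists j, edge (rim true j) \in edges C.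
    have := spoke_rim C true MC Ci; case rC: (edge (rim true i) \in _) => pC.
      by exists i.
    by exists (prev (circ true) i).
  by case: (rim_cover MC (spokeM C Ci true) Cj MC (spokeM C Ci true) Cj).
have [C' [MC' C'i C'C]] : exists C',
    [/\ C' \in M, edge (spoke i) \in edges C' & C' != C].
  have := cover_sum (spoke i); rewrite (bigD1 C) //= MC1 add1n => -[] sum1.
  have : \sum_(D | (edge (spoke i) \in edges D) && (D != C)) M D != 0.
    by rewrite sum1.
  rewrite sum_nat_eq0 => /forall_inPn[D /andP[Di DC]]; rewrite mset_neq0 => MD.
  by exists D.
have others c : (other c (prev (circ c) i), other c i) \in [:: (C, C'); (C', C)].
  have := spoke_rim C c MC Ci; have := spoke_rim C' c MC' C'i.
  have ne := rim_cover MC (spokeM C Ci c) _ MC' (spokeM C' C'i c).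
  rewrite !inE !xpair_eqE.
  case rC: (edge (rim c i) \in edges C); case rC': (edge (rim c i) \in edges C') => pC' pC.
  - by case: (ne _ rC rC') => _ /eqP; rewrite (negPf C'C).
  - rewrite (other_eq MC _ rC) ?spokeM // (other_eq MC' _ pC') ?spokeM //.
    by rewrite !eqxx orbT.
  - rewrite (other_eq MC' _ rC') ?spokeM // (other_eq MC _ pC) ?spokeM //.
    by rewrite !eqxx.
  - by case: (ne _ pC pC') => _ /eqP; rewrite (negPf C'C).
have := others false; have := others true; rewrite !inE !xpair_eqE.
have CC' : C != C' by rewrite eq_sym.
by case/orP=> /andP[/eqP-> /eqP->] /orP[]/andP[/eqP-> /eqP->];
  rewrite !eqxx ?orbT.
Qed.
End DoubleCover.
End TwoCircles.

(** * Two exhaustive searches on natural numbers *)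

(** Number of pairs of [E] with both ends already coloured, and differently, by
    the partial two-colouring [s] of the vertices [0 .. size s - 1]. *)
Definition crossings (E : seq (nat * nat)) (s : seq bool) : nat :=
  count (fun e => [&& e.1 < size s, e.2 < size s
                    & nth false s e.1 != nth false s e.2]) E.

(** Colour the vertices one by one, abandoning a branch once it has more than [b]
    bichromatic edges; every colouring that survives must have a colour class of
    at most two vertices. *)
Fixpoint cuts_trivial E b n (s : seq bool) : bool :=
  if b < crossings E s then true else
  if n is n'.+1
  then cuts_trivial E b n' (rcons s true) && cuts_trivial E b n' (rcons s false)
  else (count id s <= 2) || (count negb s <= 2).

(** The prefixes of a colouring with few bichromatic edges are never abandoned,
    because the number of bichromatic edges only grows. *)
Lemma cuts_trivialP E b (f : nat -> bool) n :
  count (fun e => f e.1 != f e.2) E <= b -> cuts_trivial E b n [::] ->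
  (count f (iota 0 n) <= 2) || (count (predC f) (iota 0 n) <= 2).
Proof.
move=> few; have fewer m : crossings E (mkseq f m) <= b.
  apply: leq_trans few; apply: sub_count => e /=; rewrite size_mkseq.
  by case/and3P=> lt1 lt2; rewrite !nth_mkseq.
suff extend k m : cuts_trivial E b k (mkseq f m) ->
    (count f (iota 0 (m + k)) <= 2) || (count (predC f) (iota 0 (m + k)) <= 2).
  exact: (extend n 0).
elim: k m => [|k IHk] m /=; rewrite ltnNge fewer /=.
  by rewrite addn0 /mkseq !count_map.
rewrite addnS -addSn => /andP[ctT ctF]; apply: IHk.
by rewrite mkseqS; case: (f m).
Qed.

Section Labellings.
Variable X : eqType.

(** A state of the second search is an equivalence of indices, given by a table
    [r] of representatives; indices beyond the table represent themselves. *)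
Definition rep (r : seq nat) k := nth k r k.

Definition merge r x y := [seq if z == rep r y then rep r x else z | z <- r].

Definition proper r (q : (nat * nat) * (nat * nat)) :=
  (rep r q.1.1 != rep r q.1.2) && (rep r q.2.1 != rep r q.2.2).

(** A constraint [((x, y), (z, t))] asks that the labels of [x] and [y] differ and
    that they are those of [z] and [t] in one of the two orders. For each
    constraint in turn the search tries both orders, identifying the indices
    that must have equal labels, and closes a branch as soon as the two indices
    at one end of a constraint have been identified. *)
Fixpoint refutes qs r (todo : seq ((nat * nat) * (nat * nat))) : bool :=
  if ~~ all (proper r) qs then true else
  if todo is ((x, y), (z, t)) :: todo' then
       refutes qs (merge (merge r x z) y t) todo'
    && refutes qs (merge (merge r x t) y z) todo'
  else false.

Definition tied (lab : nat -> X) (q : (nat * nat) * (nat * nat)) :=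
  [&& lab q.1.1 != lab q.1.2, lab q.2.1 != lab q.2.2
    & (lab q.1.1 == lab q.2.1) && (lab q.1.2 == lab q.2.2)
   || (lab q.1.1 == lab q.2.2) && (lab q.1.2 == lab q.2.1)].

Lemma merge_rep lab r x y :
  (forall k, lab (rep r k) = lab k) -> lab x = lab y ->
  forall k, lab (rep (merge r x y) k) = lab k :> X.
Proof.
move=> lab_r xy k; rewrite /merge {1}/rep.
have [ltk|lek] := ltnP k (size r); last by rewrite nth_default ?size_map.
rewrite (nth_map k) //; case: eqP => [eqk|_]; last exact: lab_r.
by rewrite lab_r xy -(lab_r y) -eqk; apply: lab_r.
Qed.

(** A labelling satisfying the constraints selects a branch along which
    identified indices have equal labels, and this branch never closes. *)
Lemma refutesP lab qs r :
  (forall k, lab (rep r k) = lab k) -> refutes qs r qs -> ~~ all (tied lab) qs.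
Proof.
move=> lab_r; apply: contraTN => tied_qs.
have proper_qs r' : (forall k, lab (rep r' k) = lab k) -> all (proper r') qs.
  move=> lab_r'; apply: sub_all tied_qs => q /and3P[ne1 ne2 _].
  apply/andP; split; [move: ne1 | move: ne2]; apply: contraNneq => eq_r.
    by rewrite -lab_r' eq_r lab_r'.
  by rewrite -lab_r' eq_r lab_r'.
have open todo r' : (forall k, lab (rep r' k) = lab k) ->
    all (tied lab) todo -> ~~ refutes qs r' todo.
  elim: todo r' => [|[[x y] [z t]] todo IHt] r' lab_r' /=.
    by rewrite proper_qs.
  case/andP=> /and3P[/= _ _ xyzt] tied_todo.
  rewrite proper_qs //= negb_and.
  case/orP: xyzt => /andP[/eqP xE /eqP yE]; apply/orP; [left|right].
    by apply: IHt => //; do 2!apply: merge_rep => //.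
  by apply: IHt => //; do 2!apply: merge_rep => //.
exact: open.
Qed.
End Labellings.

(** * The graph on 34 vertices *)

(** The cyclic orders of the spokes along the two circles. They were found by a
    computer search among the pairs of orders invariant under the negation of
    names modulo 17. *)
Definition spoke_order (c : bool) : seq nat :=
  if c then [:: 0; 14; 7; 1; 8; 6; 12; 15; 13; 4; 2; 5; 11; 9; 16; 10; 3]
  else iota 0 17.

(** Locked, since conversion would otherwise compare ordinals built by [inord]. *)
Definition circ c : seq 'I_17 := locked [seq inord i | i <- spoke_order c].

Lemma map_val_circ c : [seq val i | i <- circ c] = spoke_order c.
Proof.
have small : all (fun i => i < 17) (spoke_order c) by case: c.
by rewrite /circ -lock -map_comp map_id_in // => i /(allP small)/inordK.
Qed.

Lemma circ_uniq c : uniq (circ c).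
Proof. by rewrite -(map_inj_uniq val_inj) map_val_circ; case: c. Qed.

Lemma mem_circ c i : i \in circ c.
Proof.
rewrite -(mem_map val_inj) map_val_circ.
have /allP: all (mem (spoke_order c)) (iota 0 17) by case: c.
by apply; rewrite mem_iota ltn_ord.
Qed.

Lemma big17 : 2 < #|'I_17|. Proof. by rewrite card_ord. Qed.

Lemma val_next c (i : 'I_17) : next (circ c) i = next (spoke_order c) i :> nat.
Proof. by rewrite -map_val_circ next_map //; [apply: val_inj | apply: circ_uniq]. Qed.

Lemma val_prev c (i : 'I_17) : prev (circ c) i = prev (spoke_order c) i :> nat.
Proof. by rewrite -map_val_circ prev_map //; [apply: val_inj | apply: circ_uniq]. Qed.

(** The two ends of a spoke get consecutive codes: the first search then meets
    each spoke early, which keeps it small. *)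
Definition code (v : 'I_17 * bool) : nat := v.2 + (v.1).*2.
Definition decode m : 'I_17 * bool := (inord m./2, odd m).

Lemma codeK : cancel code decode.
Proof.
case=> i c; rewrite /decode /code /= half_bit_double inord_val.
by rewrite oddD odd_double addbF; case: c.
Qed.

Definition counterexample := two_circle_graph circ_uniq mem_circ big17.

Definition counterexample_circle := circle circ_uniq mem_circ big17.

Definition code_links : seq (nat * nat) :=
     [seq (i.*2, i.*2.+1) | i <- iota 0 17]
  ++ [seq (i.*2, (next (spoke_order false) i).*2) | i <- iota 0 17]
  ++ [seq (i.*2.+1, (next (spoke_order true) i).*2.+1) | i <- iota 0 17].

(** The constraint of spoke [i]: the two rim edges at either of its ends, where
    the rim edge leaving a vertex bears the code of that vertex. *)
Definition code_rims : seq ((nat * nat) * (nat * nat)) :=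
  [seq (((prev (spoke_order false) i).*2, i.*2),
        ((prev (spoke_order true) i).*2.+1, i.*2.+1)) | i <- iota 0 17].

Lemma code_head c i : code (head circ (Some c, i)) = c + (next (spoke_order c) i).*2.
Proof. by rewrite -val_next. Qed.

Lemma count_links (S : {set 'I_17 * bool}) :
  count (fun e => (decode e.1 \in S) != (decode e.2 \in S)) code_links
    <= #|edge_cut counterexample S|.
Proof.
pose L := [seq (k, i) | k <- [:: None; Some false; Some true], i <- enum 'I_17].
have -> : code_links = [seq (code (tail u), code (head circ u)) | u <- L].
  rewrite /L /= cats0 !map_cat /code_links -val_enum_ord -!map_comp.
  by congr (_ ++ (_ ++ _)); apply: eq_map => i; rewrite /comp ?code_head.
rewrite /counterexample card_edge_cut count_map -size_filter cardE; apply: uniq_leq_size.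
  rewrite filter_uniq // allpairs_uniq ?enum_uniq //.
  by move=> [a b] [a' b'] _ _ /= [-> ->].
by move=> u; rewrite mem_filter mem_enum /= !codeK inE => /andP[].
Qed.

Lemma count_code (S : {set 'I_17 * bool}) :
  #|S| <= count (fun m => decode m \in S) (iota 0 34).
Proof.
rewrite cardE -(size_map code) -size_filter; apply: uniq_leq_size.
  by rewrite (map_inj_uniq (can_inj codeK)) enum_uniq.
move=> _ /mapP[[i c] + ->]; rewrite mem_enum => vS.
rewrite mem_filter codeK vS mem_iota add0n -[34]/(17.*2) -ltn_half_double.
by rewrite half_bit_double ltn_ord.
Qed.

(** By the first search, a set of vertices with at most four boundary edges, or
    its complement, has at most two elements. *)
Lemma counterexample_cyclically_connected : cyclically_edge_connected 5 counterexample.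
Proof.
apply: cyclically_edge_connectedI => S bigS bigSC.
rewrite leqNgt ltnS; apply/negP => small.
have few := leq_trans (count_links S) small.
have := cuts_trivialP (f := fun m => decode m \in S) (n := 34) few.
case/(_ _)/orP; first by vm_compute.
  by rewrite leqNgt (leq_trans bigS) ?count_code.
rewrite leqNgt (leq_trans bigSC) // (leq_trans (count_code _)) //.
by apply: sub_count => m /=; rewrite inE.
Qed.

(** Labelling each rim edge by its second cover would satisfy the constraints of
    all spokes, which the search excludes. *)
Lemma counterexample_no_cover (M : {mset graph ('I_17 * bool)%type}%mset) :
  cycle_double_cover counterexample M ->
  ~ (forall c, counterexample_circle c \in M).
Proof.
move=> covM circM.
have [lab labE] : exists lab : nat -> graph ('I_17 * bool)%type,
    forall (c : bool) (i : 'I_17),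
    other circ_uniq mem_circ big17 M c i = lab (c + i.*2).
  exists (fun m => other circ_uniq mem_circ big17 M (decode m).2 (decode m).1).
  by move=> c i; rewrite (codeK (i, c)).
have tied_rims : all (tied lab) code_rims.
  rewrite /code_rims -val_enum_ord -map_comp all_map; apply/allP => i _.
  have := other_spoke covM circM i.
  by rewrite !labE !val_prev => -[ne0 ne1 eqs]; apply/and3P; split.
apply/negP: tied_rims; apply: (@refutesP _ lab _ (iota 0 34)).
  move=> k; rewrite /rep; have [ltk|lek] := ltnP k 34.
    by rewrite nth_iota.
  by rewrite nth_default // size_iota.
by vm_compute.
Qed.

Theorem mainTheorem4 :
  ~ (forall (T : finType) (G C1 C2 : graph T),
       permutation_graph G ->
       chordless_cycle G C1 ->
       chordless_cycle G C2 ->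
       two_factor G (graph_union C1 C2) ->
       cyclically_edge_connected 5 G ->
       ~ (exists M : {mset graph T}%mset,
            [/\ cycle_double_cover G M, C1 \in M & C2 \in M]) ->
       isomorphic G petersen).
Proof.
move/(_ _ counterexample (counterexample_circle false) (counterexample_circle true)).
case; try exact: circle_chordless.
- exact: two_circle_permutation.
- exact: circles_two_factor.
- exact: counterexample_cyclically_connected.
- by case=> M [covM M0 M1]; apply: (counterexample_no_cover covM) => -[].
(* The Petersen graph has ten vertices. *)
move=> f [f_inj fV _]; have := card_in_imset f_inj.
by rewrite fV cardsT card_prod card_ord card_bool card_draws card_ord.
Qed.
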